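(* For every $n\ge 1$, $|\mathcal{RS}_n(231,213)|=F_{n+1}$.
   Context: For $\sigma\in\mathfrak{S}_n$, a double descent is an index $i$ with $\sigma_i>\sigma_{i+1}>\sigma_{i+2}$. The permutation $\sigma$ is simsun if for every $k$, the subword of $\sigma$ consisting of the letters in $\{1,\dots,k\}$ (in the order they appear in $\sigma$) has no double descent. For $\omega\in\mathfrak{S}_t$, $\sigma$ contains an $\omega$-pattern if there are indices $i_1<\cdots<i_t$ with $\sigma_{i_j}<\sigma_{i_k}$ iff $\omega_j<\omega_k$; otherwise $\sigma$ avoids $\omega$. $\mathcal{RS}_n(231,213)$ is the set of simsun permutations in $\mathfrak{S}_n$ avoiding both $231$ and $213$. $F_n$ is the Fibonacci number with $F_1=F_2=1$, $F_n=F_{n-1}+F_{n-2}$. *)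

(* Defs.v *)
From mathcomp Require Import all_boot all_fingroup.
Set Implicit Arguments.
Unset Strict Implicit.
Unset Printing Implicit Defensive.

(* MathComp's 'S_n permutes {0, ..., n-1}; [one_line s] is the word
   s_1 s_2 ... s_n on the letters 1, ..., n. *)
Definition one_line (n : nat) (s : 'S_n) : seq nat :=
  [seq (s i : nat).+1 | i <- enum 'I_n].

Definition double_descent (w : seq nat) (i : nat) : bool :=
  [&& i.+2 < size w, nth 0 w i > nth 0 w i.+1 & nth 0 w i.+1 > nth 0 w i.+2].

Definition has_double_descent (w : seq nat) : bool :=
  [exists i : 'I_(size w), double_descent w i].

Definition subword_upto (k : nat) (w : seq nat) : seq nat :=
  [seq a <- w | 1 <= a <= k].

(* k ranges over 0, ..., n; the subword for k > n is the whole word. *)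
Definition simsun (n : nat) (s : 'S_n) : bool :=
  [forall k : 'I_n.+1, ~~ has_double_descent (subword_upto k (one_line s))].

Definition contains (n t : nat) (s : 'S_n) (w : 'S_t) : bool :=
  [exists i : {ffun 'I_t -> 'I_n},
     [forall j : 'I_t, forall k : 'I_t, (j < k) ==> (i j < i k)]
  && [forall j : 'I_t, forall k : 'I_t, (s (i j) < s (i k)) == (w j < w k)]].

Definition avoids (n t : nat) (s : 'S_n) (w : 'S_t) : bool :=
  ~~ contains s w.

Definition word3 (a b c : nat) (i : 'I_3) : 'I_3 :=
  inord (nth 0 [:: a; b; c] i).-1.

Lemma word231_inj : injective (word3 2 3 1).
Proof.
by move=> [[|[|[|//]]] ?] [[|[|[|//]]] ?] /(congr1 val);
  rewrite /= ?inordK //= => _; apply: val_inj.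
Qed.

Lemma word213_inj : injective (word3 2 1 3).
Proof.
by move=> [[|[|[|//]]] ?] [[|[|[|//]]] ?] /(congr1 val);
  rewrite /= ?inordK //= => _; apply: val_inj.
Qed.

Definition p231 : 'S_3 := perm word231_inj.
Definition p213 : 'S_3 := perm word213_inj.

Lemma one_line_p231 : one_line p231 = [:: 2; 3; 1].
Proof.
rewrite /one_line; apply: (@eq_from_nth _ 0); first by rewrite size_map size_enum_ord.
rewrite size_map size_enum_ord => i lti.
rewrite (nth_map ord0) ?size_enum_ord // permE /word3 nth_enum_ord //.
by case: i lti => [|[|[|//]]] _ /=; rewrite inordK.
Qed.

Lemma one_line_p213 : one_line p213 = [:: 2; 1; 3].
Proof.
rewrite /one_line; apply: (@eq_from_nth _ 0); first by rewrite size_map size_enum_ord.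
rewrite size_map size_enum_ord => i lti.
rewrite (nth_map ord0) ?size_enum_ord // permE /word3 nth_enum_ord //.
by case: i lti => [|[|[|//]]] _ /=; rewrite inordK.
Qed.

Definition RS_231_213 (n : nat) : {set 'S_n} :=
  [set s : 'S_n | [&& simsun s, avoids s p231 & avoids s p213]].

Fixpoint fib (n : nat) : nat :=
  match n with
  | 0 => 0
  | 1 => 1
  | (m.+1 as p).+1 => fib p + fib m
  end.

(* Main.v *)
Require Import Defs.
From mathcomp Require Import all_boot all_fingroup.
From mathcomp Require Import zify.

(** A permutation avoids 231 and 213 iff each of its letters is the smallest
or the largest letter of the suffix it starts.  If the first letter is the
minimum, it creates no double descent in any subword and can be removed.  If
it is the maximum, the next letter must be the minimum of what follows, since
otherwise the first three letters form a double descent; conversely the pair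
(maximum, minimum) can be put in front of any such word.  This gives the
Fibonacci recursion. *)

(** * The recursive list of words and its Fibonacci length *)

Fixpoint suffix_extremal (w : seq nat) : bool :=
  if w is x :: v then
    (all (ltn x) v || all (gtn x) v) && suffix_extremal v
  else true.

(** The letters are [lo], ..., [lo + n - 1]. The parameter [lo] makes the recursion close up: once
    the minimum, or the maximum and the minimum, are removed, the rest lives on an interval starting
    at [lo.+1]. *)
Fixpoint rs_words (n lo : nat) : seq (seq nat) :=
  match n with
  | 0 => [:: [::]]
  | 1 => [:: [:: lo]]
  | (m.+1 as p).+1 =>
      [seq lo :: w | w <- rs_words p lo.+1]
      ++ [seq [:: lo + p, lo & w] | w <- rs_words m lo.+1]
  end.

Lemma rs_wordsSS n lo : rs_words n.+2 lo =
  [seq lo :: w | w <- rs_words n.+1 lo.+1]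
  ++ [seq [:: lo + n.+1, lo & w] | w <- rs_words n lo.+1].
Proof. by []. Qed.

Lemma nat_ind2 (P : nat -> Prop) :
  P 0 -> P 1 -> (forall n, P n -> P n.+1 -> P n.+2) -> forall n, P n.
Proof.
move=> P0 P1 PSS n; suff [] : P n /\ P n.+1 by [].
by elim: n => [|n [Pn PSn]]; split=> //; apply: PSS.
Qed.

Lemma size_rs_words n lo : size (rs_words n lo) = fib n.+1.
Proof.
elim/nat_ind2: n lo => [||n IHn IHSn] lo //.
by rewrite rs_wordsSS size_cat !size_map IHn IHSn.
Qed.

Lemma uniq_rs_words n lo : uniq (rs_words n lo).
Proof.
elim/nat_ind2: n lo => [||n IHn IHSn] lo //.
rewrite rs_wordsSS cat_uniq !map_inj_uniq ?IHn ?IHSn /=; first last.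
- by move=> u v [].
- by move=> u v [].
(* The two halves are disjoint since their first letters are [lo] and [lo + n.+1]. *)
rewrite andbT; apply/hasPn=> _ /mapP[u _ ->]; apply/mapP=> -[v _ [eq_lo _]].
lia.
Qed.

(** * Double descents and extremal first letters *)

Lemma has_double_descent_cons x w :
  has_double_descent (x :: w)
  = double_descent (x :: w) 0 || has_double_descent w.
Proof.
apply/existsP/orP=> [[[[|i] lti] dd]|[dd|/existsP[i dd]]].
- by left.
- by right; apply/existsP; exists (Ordinal (lti : i < size w)).
- by exists ord0.
- by exists (lift ord0 i).
Qed.

Lemma has_double_descent_min x w :
  all (ltn x) w -> has_double_descent (x :: w) = has_double_descent w.
Proof.
rewrite has_double_descent_cons => ltxw.
suff -> : double_descent (x :: w) 0 = false by [].
case: w ltxw => [|y w] //= /andP[ltxy _].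
by apply/negP => /and3P[_ /= ltyx _]; lia.
Qed.

Lemma mem_iota_perm w lo n x :
  perm_eq w (iota lo n) -> (x \in w) = (lo <= x < lo + n).
Proof. by move=> /perm_mem ->; rewrite mem_iota. Qed.

(** The letter [lo] occurs somewhere, and not in [w], whose letters all exceed [x >= lo]. *)
Lemma perm_iota_min w lo n x : perm_eq (x :: w) (iota lo n.+1) ->
  all (ltn x) w -> x = lo.
Proof.
move=> pw /allP ltxw; have memw y := mem_iota_perm _ _ _ y pw.
have := memw x; have := memw lo; rewrite !inE eqxx.
by case/boolP: (lo \in w) => [/ltxw /=|_]; lia.
Qed.

Lemma perm_iota_max w lo n x : perm_eq (x :: w) (iota lo n.+1) ->
  all (gtn x) w -> x = lo + n.
Proof.
move=> pw /allP ltwx; have memw y := mem_iota_perm _ _ _ y pw.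
have := memw x; have := memw (lo + n); rewrite !inE eqxx.
by case/boolP: (lo + n \in w) => [/ltwx /=|_]; lia.
Qed.

Lemma perm_cons_iota_max w lo n :
  perm_eq (lo + n :: w) (iota lo n.+1) = perm_eq w (iota lo n).
Proof.
rewrite -addn1 iotaD /= -(perm_cons (lo + n) w).
have /permPr -> // : perm_eq (iota lo n ++ [:: lo + n]) (lo + n :: iota lo n).
by rewrite perm_catC.
Qed.

(** Without bounds tied to the alphabet, the condition applies to the shifted words met in the
    recursion; [simsunP] recovers [simsun]. *)
Definition simsun_word (w : seq nat) : Prop :=
  forall k, ~~ has_double_descent [seq a <- w | a <= k].

Lemma all_filterW (T : Type) (p a : pred T) (w : seq T) :
  all p w -> all p (filter a w).
Proof. by rewrite all_filter; apply: sub_all => x /= ->; rewrite implybT. Qed.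

Lemma simsun_word_min x w :
  all (ltn x) w -> simsun_word (x :: w) <-> simsun_word w.
Proof.
move=> ltxw.
suff dd k : has_double_descent [seq a <- x :: w | a <= k]
            = has_double_descent [seq a <- w | a <= k].
  by split=> sw k; [rewrite -dd | rewrite dd]; apply: sw.
rewrite /=; case: ifP => // _; apply: has_double_descent_min.
exact: all_filterW.
Qed.

(** A bound [k] that keeps [x] also keeps [y], and any letter following [y] is larger. So the
    descent from [x] to [y] cannot be prolonged, and [y] is then removed as a minimum. *)
Lemma simsun_word_max_min x y w : y < x -> all (ltn y) w ->
  simsun_word [:: x, y & w] <-> simsun_word w.
Proof.
move=> ltyx ltyw.
suff dd k : has_double_descent [seq a <- [:: x, y & w] | a <= k]
            = has_double_descent [seq a <- y :: w | a <= k].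
  rewrite -(simsun_word_min _ _ ltyw).
  by split=> sw k; [rewrite -dd | rewrite dd]; apply: sw.
rewrite [LHS]/=; case: ifP => // lexk; rewrite /= (leq_trans (ltnW ltyx) lexk).
rewrite has_double_descent_cons.
have := all_filterW _ _ (fun a => a <= k) _ ltyw.
case: [seq a <- w | a <= k] => [|z u] //= /andP[ltyz _].
suff -> : double_descent [:: x, y, z & u] 0 = false by [].
by apply/negP => /and3P[_ _ /= ltzy]; lia.
Qed.

Lemma mem_rs_words n lo w : w \in rs_words n lo <->
  [/\ perm_eq w (iota lo n), suffix_extremal w & simsun_word w].
Proof.
(* A double descent needs three letters, which settles both base cases. *)
have short_simsun v : size v <= 2 -> simsun_word v.
  move=> size_v k; apply/existsP=> -[i /and3P[lti _ _]].
  have := size_subseq (filter_subseq (fun a => a <= k) v).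
  by move=> /leq_trans/(_ size_v)/(leq_trans lti).
elim/nat_ind2: n lo w => [||n IHn IHSn] lo w.
- rewrite inE; split=> [/eqP ->|[/perm_small_eq -> //]].
  by split=> //; apply: short_simsun.
- rewrite inE; split=> [/eqP ->|[/perm_small_eq -> //]].
  by split=> //; apply: short_simsun.
rewrite rs_wordsSS mem_cat; split=> [/orP[]/mapP[v]|].
- move=> /IHSn[pv ev sv ->].
  have ltv : all (ltn lo) v.
    by apply/allP=> a; rewrite (mem_iota_perm _ _ _ _ pv) /=; lia.
  split; first by rewrite /= perm_cons.
    by rewrite /= ltv.
  exact/simsun_word_min.
- move=> /IHn[pv ev sv ->].
  have ltv : all (ltn lo) v.
    by apply/allP=> a; rewrite (mem_iota_perm _ _ _ _ pv) /=; lia.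
  have gtv : all (gtn (lo + n.+1)) v.
    by apply/allP=> a; rewrite (mem_iota_perm _ _ _ _ pv) /=; lia.
  split; first by rewrite perm_cons_iota_max /= perm_cons.
    by rewrite /= ltv gtv ev !andbT; apply/orP; right; lia.
  by apply/simsun_word_max_min => //; lia.
case: w => [[/perm_size //]|x v [pw /= /andP[xv ev] sw]].
have [ltv|nltv] := boolP (all (ltn x) v).
  have eqx := perm_iota_min _ _ _ _ pw ltv; rewrite eqx in pw ltv sw *.
  apply/orP; left; apply/map_f/IHSn; split=> //.
    by move: pw; rewrite /= perm_cons.
  exact/(simsun_word_min _ _ ltv).
have gtv : all (gtn x) v by move: xv; rewrite (negPf nltv).
have eqx := perm_iota_max _ _ _ _ pw gtv; rewrite eqx in pw gtv sw * => {xv nltv}.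
rewrite perm_cons_iota_max in pw.
case: v pw ev sw gtv => [/perm_size //|y u] pv /= /andP[yu eu] sw /andP[ltyx gtu].
have ltu : all (ltn y) u.
  case/orP: yu => //; case: u sw {pv eu gtu} => //= z u sw /andP[/= ltzy _].
  (* The bound [lo + n.+1] is the maximal first letter, so the filter keeps the first three letters,
     which would descend twice. *)
  have /negP[] := sw (lo + n.+1).
  rewrite /= leqnn (ltnW ltyx) (ltnW (ltn_trans ltzy ltyx)).
  by rewrite has_double_descent_cons /double_descent /= ltyx ltzy.
have eqy := perm_iota_min _ _ _ _ pv ltu; rewrite eqy in pv ltu ltyx sw *.
apply/orP; right; apply/map_f/IHn; split=> //.
  by move: pv; rewrite /= perm_cons.
exact/(simsun_word_max_min _ _ _ ltyx ltu).
Qed.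

(** * Pattern containment and suffix extremality *)

Lemma contains_word3 n (s : 'S_n) a b c (w_inj : injective (word3 a b c)) :
  contains s (perm w_inj) <->
  exists i : 'I_3 -> 'I_n,
    (forall u v : 'I_3, u < v -> i u < i v) /\
    (forall u v, (s (i u) < s (i v)) = (word3 a b c u < word3 a b c v)).
Proof.
split=> [/existsP[i /andP[/forallP incr /forallP pat]]|[i [incr pat]]].
  exists i; split=> u v; first by have /forallP/(_ v)/implyP := incr u.
  by have /forallP/(_ v)/eqP := pat u; rewrite !permE.
apply/existsP; exists [ffun u => i u]; apply/andP.
split; apply/forallP=> u; apply/forallP=> v; rewrite !ffunE.
  exact/implyP/incr.
by rewrite !permE pat.
Qed.

Lemma contains_p231 n (s : 'S_n) : contains s p231 <->
  exists i j k : 'I_n, [/\ i < j, j < k, s k < s i & s i < s j].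
Proof.
rewrite contains_word3; split=> [[i [incr pat]]|[i [j [k [ij jk ki ij']]]]].
  exists (i (@Ordinal 3 0 isT)), (i (@Ordinal 3 1 isT)), (i (@Ordinal 3 2 isT)).
  by split; rewrite ?incr ?pat // /word3 !inordK.
exists (fun u => nth i [:: i; j; k] u).
split; move=> [[|[|[|//]]] ?] [[|[|[|//]]] ?]; rewrite /word3 ?inordK //=; lia.
Qed.

Lemma contains_p213 n (s : 'S_n) : contains s p213 <->
  exists i j k : 'I_n, [/\ i < j, j < k, s j < s i & s i < s k].
Proof.
rewrite contains_word3; split=> [[i [incr pat]]|[i [j [k [ij jk ji ik]]]]].
  exists (i (@Ordinal 3 0 isT)), (i (@Ordinal 3 1 isT)), (i (@Ordinal 3 2 isT)).
  by split; rewrite ?incr ?pat // /word3 !inordK.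
exists (fun u => nth i [:: i; j; k] u).
split; move=> [[|[|[|//]]] ?] [[|[|[|//]]] ?]; rewrite /word3 ?inordK //=; lia.
Qed.

(** A letter fails to be extremal exactly when a smaller and a larger letter both come later. The
    relative order of [j] and [k] is left free, so that 213 and 231 are treated together. *)
Lemma suffix_extremalP (w : seq nat) : uniq w ->
  reflect (forall i j k, i < j < size w -> i < k < size w ->
             ~~ (nth 0 w j < nth 0 w i < nth 0 w k))
          (suffix_extremal w).
Proof.
elim: w => [|x w IHw] /= => [_|/andP[xNw /IHw {}IHw]].
  by apply: ReflectT => i j k; rewrite ltn0 andbF.
apply: (iffP andP) => [[xw /IHw ew] [|i] [|j] [|k] //|ew].
- rewrite /= !ltnS => ltj ltk; apply/negP=> /andP[ltjx ltxk].
  by case/orP: xw => /allP xw;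
    [have := xw _ (mem_nth 0 ltj) | have := xw _ (mem_nth 0 ltk)];
    rewrite /=; lia.
- by rewrite /= !ltnS; apply: ew.
split; last by apply/IHw=> i j k ltj ltk; apply: (ew i.+1 j.+1 k.+1).
rewrite -[_ || _]negbK negb_or -!has_predC; apply/negP=> /andP[].
move=> /(has_nthP 0)[j ltj /= lejx] /(has_nthP 0)[k ltk /= lexk].
have /negP[] := ew 0 j.+1 k.+1 ltj ltk.
(* Negating extremality gives only weak inequalities; distinctness of the letters makes them
   strict. *)
have neqj : nth 0 w j != x by apply: contraNneq xNw => <-; apply: mem_nth.
have neqk : nth 0 w k != x by apply: contraNneq xNw => <-; apply: mem_nth.
rewrite /=; lia.
Qed.

(** * From permutations to their one-line words *)

Lemma nth_one_line n (s : 'S_n) (i : 'I_n) : nth 0 (one_line s) i = (s i).+1.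
Proof. by rewrite (nth_map i) ?size_enum_ord // nth_ord_enum. Qed.

Lemma size_one_line n (s : 'S_n) : size (one_line s) = n.
Proof. by rewrite size_map size_enum_ord. Qed.

Lemma one_line_inj n : injective (@one_line n).
Proof.
move=> s t eq_st; apply/permP=> i; apply/val_inj/succn_inj.
by rewrite -!nth_one_line eq_st.
Qed.

Lemma perm_one_lineP n (w : seq nat) :
  reflect (exists s : 'S_n, w = one_line s) (perm_eq w (iota 1 n)).
Proof.
have -> : iota 1 n = [tuple i.+1 | i < n].
  by rewrite (iotaDl 1 0) -val_enum_ord -map_comp.
apply: (iffP tuple_permP) => -[s ->]; exists s; apply: eq_map => i;
  by rewrite tnth_mktuple.
Qed.

Lemma uniq_one_line n (s : 'S_n) : uniq (one_line s).
Proof.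
by rewrite map_inj_uniq ?enum_uniq // => i j [/val_inj/perm_inj].
Qed.

Lemma suffix_extremal_one_line n (s : 'S_n) :
  suffix_extremal (one_line s) = avoids s p231 && avoids s p213.
Proof.
apply/(suffix_extremalP _ (uniq_one_line _ _))/andP; rewrite size_one_line.
  move=> es; split; apply/negP.
    move=> /contains_p231[i [j [k [ltij ltjk ltki ltij']]]].
    have := es i k j; rewrite !nth_one_line !ltnS ltki ltij' ltij !ltn_ord.
    by rewrite (ltn_trans ltij ltjk) => /(_ isT isT).
  move=> /contains_p213[i [j [k [ltij ltjk ltki ltij']]]].
  have := es i j k; rewrite !nth_one_line !ltnS ltki ltij' ltij !ltn_ord.
  by rewrite (ltn_trans ltij ltjk) => /(_ isT isT).
move=> [/negP no231 /negP no213] i j k /andP[ltij ltj] /andP[ltik ltk].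
pose oi := Ordinal (ltn_trans ltij ltj); pose oj := Ordinal ltj.
pose ok := Ordinal ltk.
rewrite (nth_one_line _ _ oi) (nth_one_line _ _ oj) (nth_one_line _ _ ok) !ltnS.
apply/negP=> /andP[ltji ltik'].
(* The smaller letter is at [j], the larger at [k]: 213 if [j] comes first, 231 if [k] does. *)
have [ltjk|ltkj|eqjk] := ltngtP j k.
- by apply: no213; apply/contains_p213; exists oi, oj, ok.
- by apply: no231; apply/contains_p231; exists oi, ok, oj.
have eqo : oj = ok by apply: val_inj.
by move: ltji; rewrite eqo ltnNge ltnW.
Qed.

Lemma simsunP n (s : 'S_n) : reflect (simsun_word (one_line s)) (simsun s).
Proof.
have mem_s a : a \in one_line s -> 0 < a <= n.
  by case/mapP=> i _ ->; rewrite /= ltn_ord.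
apply: (iffP forallP) => [ss k|ss k].
  (* All letters lie between 1 and [n], so capping [k] at [n] leaves the subword unchanged. *)
  have := ss (inord (minn k n)); rewrite /subword_upto inordK ?ltnS ?geq_minr //.
  congr (~~ has_double_descent _); apply/eq_in_filter => a /mem_s.
  by rewrite leq_min => /andP[-> ->]; rewrite andbT.
have := ss k; congr (~~ has_double_descent _).
by apply/eq_in_filter => a /mem_s /andP[->].
Qed.

Theorem theorem3p10 (n : nat) (hn : 1 <= n) : #|RS_231_213 n| = fib n.+1.
Proof.
rewrite -(size_rs_words n 1) cardE -(size_map (@one_line n)).
(* Two duplicate-free lists with the same members have equal length. *)
apply/perm_size/uniq_perm; last 1 first.
- move=> w; apply/mapP/idP => [[s]|/mem_rs_words[/perm_one_lineP[s ->] ew sw]].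
    rewrite mem_enum inE -suffix_extremal_one_line => /andP[/simsunP ss es] ->.
    by apply/mem_rs_words; split=> //; apply/perm_one_lineP; exists s.
  exists s => //; rewrite mem_enum inE -suffix_extremal_one_line ew andbT.
  exact/simsunP.
- by rewrite map_inj_uniq ?enum_uniq //; apply: one_line_inj.
- exact: uniq_rs_words.
Qed.
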